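(* Assume that the piecewise smooth system $(X_1,X_2,X_3,X_4)$ admits a sliding vector field on $\Lambda$ at $(x,0,0)$, corresponding to $(\psi_*,\phi_* )\in(-1,1)^2$ with $\tilde F_x(\psi_*,\phi_* )=(0,0)$, which is of node/focus type (i.e. $\det\mathbf D\tilde F_x(\psi_*,\phi_* )>0$), and assume further that $s_1,s_2$ given by $$s_1=(\beta_1-\beta_2)\sigma_\phi+(\beta_4-\beta_3)(1-\sigma_\phi),$$ $$s_2=(\gamma_1-\gamma_4)\sigma_\psi+(\gamma_2-\gamma_3)(1-\sigma_\psi),$$ are of the same sign, where $\sigma_\psi=(1+\psi_* )/2$ and $\sigma_\phi=(1+\phi_* )/2$. If $s_1,s_2$ are positive, then the sliding vector field is repelling, while if $s_1,s_2$ are negative, then the sliding vector field is attracting.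
   Context: Setting. Let $\mathcal U\subset\mathbb R^3$ with coordinates $(x,y,z)$, $\mathcal I$ an interval, $\Lambda=\{(x,0,0):x\in\mathcal I\}$, $\mathcal Q_1=\{y\ge0,z\ge0\}$, $\mathcal Q_2=\{y\le0,z\ge0\}$, $\mathcal Q_3=\{y\le0,z\le0\}$, $\mathcal Q_4=\{y\ge0,z\le0\}$. The piecewise smooth system is $(\dot x,\dot y,\dot z)^T=X_i$ on $\mathcal Q_i$ with smooth $X_i=(\alpha_i,\beta_i,\gamma_i)^T$; standing assumption: $\alpha_i,\beta_i,\gamma_i$ depend only on $x$ (evaluated at the fixed $x$). Put $\tilde X_i=(\beta_i,\gamma_i)^T$ and for $(\psi,\phi)\in(-1,1)^2$ let $$\tilde F_x(\psi,\phi)=\tfrac12\Big(\tfrac{\tilde X_1}{2}(1+\phi)+\tfrac{\tilde X_4}{2}(1-\phi)\Big)(1+\psi)+\tfrac12\Big(\tfrac{\tilde X_2}{2}(1+\phi)+\tfrac{\tilde X_3}{2}(1-\phi)\Big)(1-\psi).$$ Sliding. A sliding vector field on $\Lambda$ is a convex combination $\nu_1X_1+\nu_2X_2+\nu_3X_3+\nu_4X_4$ (with $\sum_i\nu_i=1$) tangent to $\Lambda$; in the paper these are given by the zeros $(\psi_*,\phi_* )\in(-1,1)^2$ of $\tilde F_x$ through $\nu_1=\sigma_\psi\sigma_\phi$, $\nu_2=(1-\sigma_\psi)\sigma_\phi$, $\nu_3=(1-\sigma_\psi)(1-\sigma_\phi)$, $\nu_4=\sigma_\psi(1-\sigma_\phi)$.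 Stability. Let $\psi,\phi:\mathbb R\to[-1,1]$ be any regularization functions: smooth ($C^k$, $k\ge1$), with positive derivative wherever the value lies in $(-1,1)$, tending to $\pm1$ at $\pm\infty$, and with $r\mapsto\psi(r^{-1}),\phi(r^{-1})$ extending smoothly to $r=0$ from either side. Put $\hat y_*=\psi^{-1}(\psi_* )$, $\hat z_*=\phi^{-1}(\phi_* )$ and $\mathbf J=\mathbf D\tilde F_x(\psi_*,\phi_* )\,\mathrm{diag}(\psi'(\hat y_* ),\phi'(\hat z_* ))$, the Jacobian of the layer problem $(\hat y',\hat z')^T=\tilde F_x(\psi(\hat y),\phi(\hat z))$ at $(\hat y_*,\hat z_* )$. The sliding vector field is attracting (repelling) if both eigenvalues of $\mathbf J$ have negative (positive) real part. *)

(* Defs.v *)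
From mathcomp Require Import all_boot all_order all_algebra.
From mathcomp Require Import all_classical all_reals all_analysis.
From mathcomp Require Import complex.

Set Implicit Arguments.
Unset Strict Implicit.
Unset Printing Implicit Defensive.

Import Order.TTheory GRing.Theory Num.Theory.
Import numFieldNormedType.Exports.

Local Open Scope classical_set_scope.
Local Open Scope ring_scope.

Definition row2 (R : realType) (a b : R) : 'rV[R]_2 :=
  \row_(j < 2) (if j == 0 then a else b).

Definition row3 (R : realType) (a b c : R) : 'rV[R]_3 :=
  \row_(j < 3) (if j == 0 then a else if j == 1 then b else c).

(* Meant for open [A] and finite-dimensional [V], where it is the usual class
   C^k: asking for all directional derivatives amounts to asking for the
   partial derivatives. *)
Fixpoint smooth_on (R : realType) (V W : normedModType R) (k : nat)
    (A : set V) (f : V -> W) : Prop :=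
  if k is k'.+1 then
    (forall a, A a -> differentiable f a) /\
    (forall v, smooth_on k' A (fun a => 'D_v f a))
  else forall a, A a -> {for a, continuous f}.

(* Points of R^3 are rows (x, y, z).  [X1], [X2], [X3], [X4] govern the motion
   on { y >= 0, z >= 0 }, { y <= 0, z >= 0 }, { y <= 0, z <= 0 } and
   { y >= 0, z <= 0 } respectively; each is defined on the whole of [dom]. *)
Record pws_system (R : realType) (k : nat) := PwsSystem {
  dom : set 'rV[R]_3;
  itv : set R;
  X1 : 'rV[R]_3 -> 'rV[R]_3;
  X2 : 'rV[R]_3 -> 'rV[R]_3;
  X3 : 'rV[R]_3 -> 'rV[R]_3;
  X4 : 'rV[R]_3 -> 'rV[R]_3;
  dom_open : open dom;
  itv_interval : is_interval itv;
  Lambda_sub : forall x, itv x -> dom (row3 x 0 0);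
  fields_smooth : forall X, [\/ X = X1, X = X2, X = X3 | X = X4] ->
    smooth_on k dom X;
  fields_x_only : forall X, [\/ X = X1, X = X2, X = X3 | X = X4] ->
    forall p q, dom p -> dom q -> p 0 0 = q 0 0 -> X p = X q
}.

Definition beta (R : realType) (X : 'rV[R]_3 -> 'rV[R]_3) (x : R) : R :=
  X (row3 x 0 0) 0 1.

Definition gamma (R : realType) (X : 'rV[R]_3 -> 'rV[R]_3) (x : R) : R :=
  X (row3 x 0 0) 0 2.

Definition tildeX (R : realType) (X : 'rV[R]_3 -> 'rV[R]_3) (x : R) : 'rV[R]_2 :=
  row2 (beta X x) (gamma X x).

Definition tildeF (R : realType) (k : nat) (S : pws_system R k) (x : R)
    (p : 'rV[R]_2) : 'rV[R]_2 :=
  let psi := p 0 0 in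
  let phi := p 0 1 in
  (2^-1 * (1 + psi)) *:
    ((1 + phi) *: (2^-1 *: tildeX (X1 S) x) +
     (1 - phi) *: (2^-1 *: tildeX (X4 S) x)) +
  (2^-1 * (1 - psi)) *:
    ((1 + phi) *: (2^-1 *: tildeX (X2 S) x) +
     (1 - phi) *: (2^-1 *: tildeX (X3 S) x)).

(* The library's [jacobian] acts on row vectors from the right, so it is the
   transpose of the usual matrix of partial derivatives. *)
Definition DtildeF (R : realType) (k : nat) (S : pws_system R k)
    (x psi phi : R) : 'M[R]_2 :=
  (jacobian (tildeF S x) (row2 psi phi))^T.

Definition sigma (R : realType) (a : R) : R := (1 + a) / 2.

Definition convex_comb (R : realType) (k : nat) (S : pws_system R k) (x : R)
    (nu1 nu2 nu3 nu4 : R) : 'rV[R]_3 :=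
  let p := row3 x 0 0 in
  nu1 *: X1 S p + nu2 *: X2 S p + nu3 *: X3 S p + nu4 *: X4 S p.

Definition tangent_to_Lambda (R : realType) (v : 'rV[R]_3) : Prop :=
  exists a, v = row3 a 0 0.

Definition sliding_vector (R : realType) (k : nat) (S : pws_system R k) (x : R)
    (v : 'rV[R]_3) : Prop :=
  exists nu1 nu2 nu3 nu4 : R,
    [/\ [/\ 0 <= nu1, 0 <= nu2, 0 <= nu3 & 0 <= nu4],
        nu1 + nu2 + nu3 + nu4 = 1,
        v = convex_comb S x nu1 nu2 nu3 nu4 &
        tangent_to_Lambda v].

Definition corresponds_to (R : realType) (k : nat) (S : pws_system R k) (x : R)
    (v : 'rV[R]_3) (psi phi : R) : Prop :=
  let spsi := sigma psi in
  let sphi := sigma phi in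
  [/\ -1 < psi < 1, -1 < phi < 1,
      tildeF S x (row2 psi phi) = 0 &
      v = convex_comb S x (spsi * sphi) ((1 - spsi) * sphi)
            ((1 - spsi) * (1 - sphi)) (spsi * (1 - sphi))].

Definition node_focus (R : realType) (k : nat) (S : pws_system R k)
    (x psi phi : R) : Prop :=
  0 < \det (DtildeF S x psi phi).

Definition s1 (R : realType) (k : nat) (S : pws_system R k) (x phi : R) : R :=
  (beta (X1 S) x - beta (X2 S) x) * sigma phi +
  (beta (X4 S) x - beta (X3 S) x) * (1 - sigma phi).

Definition s2 (R : realType) (k : nat) (S : pws_system R k) (x psi : R) : R :=
  (gamma (X1 S) x - gamma (X4 S) x) * sigma psi +
  (gamma (X2 S) x - gamma (X3 S) x) * (1 - sigma psi).

(* For finite k, a C^k function on a half-line ]0, +oo[ extends in a C^k way to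
   [0, +oo[ iff it is the restriction of a C^k function on the whole line. *)
Record regularization (R : realType) (k : nat) (f : R -> R) : Prop := {
  reg_smooth : smooth_on k [set: R] f;
  reg_range : forall t, -1 <= f t <= 1;
  reg_incr : forall t, -1 < f t < 1 -> 0 < derive1 f t;
  reg_pinfty : f t @[t --> +oo] --> (1 : R);
  reg_ninfty : f t @[t --> -oo] --> (-1 : R);
  reg_inv_right : exists g : R -> R,
    smooth_on k [set: R] g /\ forall r : R, 0 < r -> g r = f r^-1;
  reg_inv_left : exists g : R -> R,
    smooth_on k [set: R] g /\ forall r : R, r < 0 -> g r = f r^-1
}.

(* For a regularization function [f] and -1 < a < 1 the preimage is a
   singleton. *)
Definition reg_inverse (R : realType) (f : R -> R) (a : R) : R :=
  xget 0 [set t | f t = a].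

Definition layer_jacobian (R : realType) (k : nat) (S : pws_system R k)
    (psi phi : R -> R) (x psis phis : R) : 'M[R]_2 :=
  let yhat := reg_inverse psi psis in
  let zhat := reg_inverse phi phis in
  DtildeF S x psis phis *m diag_mx (row2 (derive1 psi yhat) (derive1 phi zhat)).

Definition complex_eigenvalue (R : realType) (n : nat) (A : 'M[R]_n)
    (l : complex R) : Prop :=
  eigenvalue (map_mx (real_complex R) A) l.

Definition attracting (R : realType) (k : nat) (S : pws_system R k)
    (psi phi : R -> R) (x psis phis : R) : Prop :=
  forall l, complex_eigenvalue (layer_jacobian S psi phi x psis phis) l ->
    complex.Re l < 0.

Definition repelling (R : realType) (k : nat) (S : pws_system R k)
    (psi phi : R -> R) (x psis phis : R) : Prop :=
  forall l, complex_eigenvalue (layer_jacobian S psi phi x psis phis) l ->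
    0 < complex.Re l.

(* Main.v *)
(* The diagonal entries of D tildeF at (psi, phi) are s1 / 2 and s2 / 2, and the
   layer Jacobian is D tildeF times a diagonal matrix with positive entries.
   Hence its determinant is positive and its trace has the common sign of s1 and
   s2.  An eigenvalue l of a real 2x2 matrix solves l^2 - T l + D = 0 with T the
   trace and D the determinant: if l is not real then Re l = T / 2, and if l is
   real then T l = l^2 + D > 0; either way Re l has the sign of T. *)
Require Import Defs.
From mathcomp Require Import all_boot all_order all_algebra.
From mathcomp Require Import all_classical all_reals all_analysis.
From mathcomp Require Import complex.
From mathcomp Require Import ring lra.

Import Order.TTheory GRing.Theory Num.Theory.
Import numFieldNormedType.Exports.

Local Open Scope classical_set_scope.
Local Open Scope ring_scope.

Lemma det_mx22 (R : comNzRingType) (A : 'M[R]_2) :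
  \det A = A 0 0 * A 1 1 - A 0 1 * A 1 0.
Proof.
rewrite (expand_det_row _ 0) !big_ord_recl big_ord0 addr0 /cofactor !det_mx11.
rewrite !mxE /= expr0 expr1 mul1r mulN1r mulrN.
by congr (_ * A _ _ - A _ _ * A _ _); apply/val_inj.
Qed.

Lemma mxtrace22 (R : nzRingType) (A : 'M[R]_2) : \tr A = A 0 0 + A 1 1.
Proof.
rewrite /mxtrace !big_ord_recl big_ord0 addr0.
by congr (_ + A _ _); apply/val_inj.
Qed.

(** A left eigenvector lies in the kernel of [A - l%:M], whose determinant therefore vanishes;
    expanding it gives the characteristic polynomial. *)
Lemma eigenvalue22 (F : fieldType) (A : 'M[F]_2) (l : F) :
  eigenvalue A l -> l ^+ 2 - \tr A * l + \det A = 0.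
Proof.
case/eigenvalueP => v vA v0.
have : \det (A - l%:M) == 0.
  by apply/det0P; exists v; rewrite // mulmxBr vA mul_mx_scalar subrr.
move/eqP; rewrite !det_mx22 mxtrace22 !mxE /= => <-.
by ring.
Qed.

Lemma Re_eigenvalue22 (R : realType) (A : 'M[R]_2) (l : complex R) :
  0 < \det A -> \tr A != 0 -> complex_eigenvalue A l ->
  0 < \tr A * complex.Re l.
Proof.
move=> detA trA /eigenvalue22; rewrite trace_map_mx det_map_mx.
case: l => a b /eqP; rewrite expr2 eq_complex /= => /andP[/eqP re /eqP im].
have [b0|b0] := eqVneq b 0.
  have -> : \tr A * a = a ^+ 2 + \det A by move: re; rewrite b0; lra.
  by rewrite ltr_wpDl ?sqr_ge0.
(* The imaginary part of the equation reads 2 a b = T b with T the trace. After cancelling b, twice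
   the product in the goal is T^2, positive since T is nonzero. *)
have tr2a : \tr A = 2 * a.
  by apply: (mulIf b0); move: im; lra.
rewrite -(pmulr_rgt0 _ (ltr0Sn R 1)).
have -> : 2 * (\tr A * a) = \tr A ^+ 2 by rewrite tr2a; ring.
by rewrite lt_def sqrf_eq0 trA sqr_ge0.
Qed.

(** [tildeF] has degree at most one in psi and in phi separately, so its increments along each axis
    are exactly linear and the partial derivatives can be read off algebraically. *)
Lemma derive_affine_line (R : numFieldType) (V W : normedModType R)
    (f : V -> W) (a v : V) (w : W) :
  (forall h : R, f (h *: v + a) = f a + h *: w) -> 'D_v f a = w.
Proof.
move=> fE; apply/cvg_lim => //.
apply: (@cvg_trans _ ((fun=> w) @ (0 : R)^')); last exact: cvg_cst.
apply: near_eq_cvg; near=> h.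
rewrite /= fE addrC addKr scalerA mulVf ?scale1r //.
by near: h; exact: nbhs_dnbhs_neq.
Unshelve. all: by end_near. Qed.

(** [jacobian] is built from the differential; [deriveE] identifies it with directional derivatives
    only where the map is differentiable. *)
Lemma differentiable_tildeF (R : realType) (k : nat) (S : pws_system R k)
    (x : R) (p : 'rV[R]_2) :
  differentiable (tildeF S x) p.
Proof.
have dcoord i : differentiable (fun q : 'rV[R]_2 => q 0 i) p.
  exact: differentiable_coord.
have dP i : differentiable (fun q : 'rV[R]_2 => 1 + q 0 i) p.
  by apply: differentiableD => //; exact: differentiable_cst.
have dN i : differentiable (fun q : 'rV[R]_2 => 1 - q 0 i) p.
  by apply: differentiableB => //; exact: differentiable_cst.
have dM (g h : 'rV[R]_2 -> R) (w : 'rV[R]_2) :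
    differentiable g p -> differentiable h p ->
    differentiable (fun q => (2^-1 * g q * h q) *: w) p.
  move=> dg dh; apply: differentiableZl; apply: differentiableM => //.
  by apply: differentiableM => //; exact: differentiable_cst.
(* Expanded this way, each term is a product of two affine coordinate functions times a constant
   vector, the shape covered by [dM]. *)
rewrite (_ : tildeF S x = fun q =>
    (2^-1 * (1 + q 0 0) * (1 + q 0 1)) *: (2^-1 *: tildeX (X1 S) x) +
    (2^-1 * (1 + q 0 0) * (1 - q 0 1)) *: (2^-1 *: tildeX (X4 S) x) +
    ((2^-1 * (1 - q 0 0) * (1 + q 0 1)) *: (2^-1 *: tildeX (X2 S) x) +
     (2^-1 * (1 - q 0 0) * (1 - q 0 1)) *: (2^-1 *: tildeX (X3 S) x))).
  by do 2 apply: differentiableD; exact: dM.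
by apply/funext => q; rewrite /tildeF !scalerDr !scalerA.
Qed.

Lemma DtildeF00 (R : realType) (k : nat) (S : pws_system R k)
    (x psi phi : R) : DtildeF S x psi phi 0 0 = s1 S x phi / 2.
Proof.
(* The partial derivative in psi: [4^-1] collects the two halves in [tildeF], and [sigma phi]
   absorbs one of them, which leaves [s1 / 2]. *)
pose w := 4^-1 *: ((1 + phi) *: (tildeX (X1 S) x - tildeX (X2 S) x) +
  (1 - phi) *: (tildeX (X4 S) x - tildeX (X3 S) x)).
rewrite 2!mxE -deriveE; last exact: differentiable_tildeF.
rewrite (@derive_affine_line _ _ _ _ _ _ w).
  by rewrite /w /tildeX /s1 /sigma !mxE /=; field.
move=> h; rewrite /w /tildeF !mxE /= !mulr0 !add0r mulr1.
by apply/rowP => j; rewrite !mxE; field.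
Qed.

Lemma DtildeF11 (R : realType) (k : nat) (S : pws_system R k)
    (x psi phi : R) : DtildeF S x psi phi 1 1 = s2 S x psi / 2.
Proof.
pose w := 4^-1 *: ((1 + psi) *: (tildeX (X1 S) x - tildeX (X4 S) x) +
  (1 - psi) *: (tildeX (X2 S) x - tildeX (X3 S) x)).
rewrite 2!mxE -deriveE; last exact: differentiable_tildeF.
rewrite (@derive_affine_line _ _ _ _ _ _ w).
  by rewrite /w /tildeX /s2 /sigma !mxE /=; field.
move=> h; rewrite /w /tildeF !mxE /= !mulr0 !add0r mulr1.
by apply/rowP => j; rewrite !mxE; field.
Qed.

(** The limits at both infinities put values of [f] on either side of [a]. Continuity then yields a
    preimage, so [xget] never returns its default 0. *)
Lemma reg_inverseK (R : realType) (k : nat) (f : R -> R) (a : R) :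
  regularization k f -> -1 < a < 1 -> f (reg_inverse f a) = a.
Proof.
move=> fr /andP[a1 a2].
have fcont : continuous f.
  move: (reg_smooth fr); case: k {fr} => [|k] /= fs t; first exact: fs.
  by apply: differentiable_continuous; apply fs.1.
have [u fu] : exists u, f u < a.
  have : \forall t \near -oo, f t < a by exact: (cvgr_lt _ (reg_ninfty fr)).
  by move=> /filter_ex[u ?]; exists u.
have [w fw] : exists w, a < f w.
  have : \forall t \near +oo, a < f t by exact: (cvgr_gt _ (reg_pinfty fr)).
  by move=> /filter_ex[w ?]; exists w.
have fwithin c d : {within `[c, d], continuous f}.
  exact: continuous_subspaceT.
have [c fc] : exists c, f c = a.
  (* The points [u] and [w] come from separate limits, so their order is unknown and the
     intermediate value theorem is applied in both cases. *)
  have [uw|/ltW wu] := leP u w.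
    have [|c _ fc] := @IVT R f u w a uw (fwithin _ _); last by exists c.
    by rewrite ge_min le_max (ltW fu) (ltW fw) orbT.
  have [|c _ fc] := @IVT R f w u a wu (fwithin _ _); last by exists c.
  by rewrite ge_min le_max (ltW fu) (ltW fw) orbT.
by rewrite /reg_inverse; case: xgetP => [t _|/(_ c)].
Qed.

Theorem proposition9 (R : realType) (k : nat) (k_ge1 : (1 <= k)%N)
    (S : pws_system R k) (x : R) (x_itv : itv S x)
    (v : 'rV[R]_3) (psis phis : R)
    (v_sliding : sliding_vector S x v)
    (v_corr : corresponds_to S x v psis phis)
    (nodefocus : node_focus S x psis phis)
    (same_sign : 0 < s1 S x phis * s2 S x psis)
    (psi phi : R -> R)
    (psi_reg : regularization k psi) (phi_reg : regularization k phi) :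
  (0 < s1 S x phis -> 0 < s2 S x psis -> repelling S psi phi x psis phis) /\
  (s1 S x phis < 0 -> s2 S x psis < 0 -> attracting S psi phi x psis phis).
Proof.
have [psis1 phis1 _ _] := v_corr.
have dpsi : 0 < derive1 psi (reg_inverse psi psis).
  by apply: (reg_incr psi_reg); rewrite (reg_inverseK _ _ _ _ psi_reg).
have dphi : 0 < derive1 phi (reg_inverse phi phis).
  by apply: (reg_incr phi_reg); rewrite (reg_inverseK _ _ _ _ phi_reg).
have detJ : 0 < \det (layer_jacobian S psi phi x psis phis).
  rewrite det_mulmx det_diag !big_ord_recl big_ord0 !mxE /= mulr1.
  by rewrite mulr_gt0 // mulr_gt0.
have trJ : \tr (layer_jacobian S psi phi x psis phis) =
    s1 S x phis / 2 * derive1 psi (reg_inverse psi psis) +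
    s2 S x psis / 2 * derive1 phi (reg_inverse phi phis).
  (* Right multiplication by a diagonal matrix scales columns, so each diagonal entry picks up its
     own slope. *)
  have JE i : layer_jacobian S psi phi x psis phis i i =
      DtildeF S x psis phis i i *
      row2 (derive1 psi (reg_inverse psi psis))
        (derive1 phi (reg_inverse phi phis)) 0 i.
    by rewrite /layer_jacobian mul_mx_diag mxE.
  by rewrite mxtrace22 !JE DtildeF00 DtildeF11 !mxE.
(* [Re_l] still asks for a nonzero trace; each branch first finds the sign of the trace, which
   settles this and then passes to the real part of [l]. *)
split=> s1_sign s2_sign l /(Re_eigenvalue22 _ _ _ detJ) Re_l.
- have tr_gt0 : 0 < \tr (layer_jacobian S psi phi x psis phis).
    by rewrite trJ addr_gt0 // mulr_gt0 // divr_gt0.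
  by rewrite -(pmulr_rgt0 _ tr_gt0) Re_l // gt_eqF.
- have tr_lt0 : \tr (layer_jacobian S psi phi x psis phis) < 0.
    rewrite trJ -oppr_gt0 opprD addr_gt0 // -mulNr mulr_gt0 //.
      by rewrite -mulNr divr_gt0 ?oppr_gt0.
    by rewrite -mulNr divr_gt0 ?oppr_gt0.
  by rewrite -(nmulr_rgt0 _ tr_lt0) Re_l // lt_eqF.
Qed.
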